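(* Let $K$ be a (computable) perfect field, let $\mathcal{O}=\{t_1,\dots,t_5\}=\{1,y,x,y^2,x^2\}$ be the L-shape order ideal with border $\partial\mathcal{O}=\{b_1,\dots,b_5\}=\{xy,y^3,xy^2,x^2y,x^3\}$, and let $I(\mathbb{B}_{\mathcal{O}})\subseteq K[C]=K[c_{11},\dots,c_{55}]$ be the ideal defining the L-shape border basis scheme. The tuple of indeterminates $$Z=(c_{11},c_{12},c_{13},c_{14},c_{15},c_{23},c_{24},c_{25},c_{31},c_{32},c_{34},c_{44},c_{53})$$ defines a best separating re-embedding of $I(\mathbb{B}_{\mathcal{O}})$, i.e., a separating re-embedding for which $\#Z$ is as large as possible. This re-embedding is a $K$-algebra isomorphism $$\Phi:\ B_{\mathcal{O}}\longrightarrow K[C\setminus Z]/\langle f_1,f_2\rangle$$ where $$\begin{aligned} f_1={}& c_{21}c_{41}^2c_{51}^2+c_{41}^2c_{43}c_{51}^2+c_{41}c_{45}c_{51}^3+c_{41}^2c_{42}c_{51}-c_{41}^3c_{52}-c_{41}^2c_{51}c_{54}\\ &+c_{21}c_{41}c_{51}+c_{45}c_{51}^2-c_{41}c_{51}c_{55}+c_{41}c_{42}+c_{41}c_{54}+c_{21}-c_{43},\end{aligned}$$ $$\begin{aligned} f_2={}& -c_{21}^2c_{41}^3c_{51}^5-2c_{21}c_{41}^3c_{43}c_{51}^5-c_{41}^3c_{43}^2c_{51}^5-2c_{21}c_{41}^2c_{45}c_{51}^6-2c_{41}^2c_{43}c_{45}c_{51}^6\\ &-c_{41}c_{45}^2c_{51}^7-c_{21}c_{41}^3c_{42}c_{51}^4-c_{41}^3c_{42}c_{43}c_{51}^4-c_{41}^2c_{42}c_{45}c_{51}^5+c_{21}c_{41}^3c_{51}^4c_{54}\\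 &+c_{41}^3c_{43}c_{51}^4c_{54}+c_{41}^2c_{45}c_{51}^5c_{54}-c_{41}^4c_{42}c_{51}^2c_{52}+c_{41}^5c_{51}c_{52}^2+c_{41}^4c_{51}^2c_{52}c_{54}\\ &-c_{41}^2c_{42}c_{43}c_{51}^3-c_{21}c_{41}^3c_{51}^2c_{52}+c_{41}^3c_{43}c_{51}^2c_{52}-c_{41}^2c_{45}c_{51}^3c_{52}\\ &-2c_{21}c_{41}^2c_{51}^3c_{54}-c_{41}^2c_{43}c_{51}^3c_{54}-2c_{41}c_{45}c_{51}^4c_{54}-c_{41}^2c_{42}c_{51}^3c_{55}\\ &+2c_{41}^3c_{51}^2c_{52}c_{55}+c_{41}^2c_{51}^3c_{54}c_{55}+2c_{21}c_{41}c_{43}c_{51}^3+3c_{41}c_{43}^2c_{51}^3+2c_{43}c_{45}c_{51}^4\\ &-c_{41}^4c_{52}^2-2c_{41}^3c_{51}c_{52}c_{54}+2c_{41}c_{43}c_{51}^3c_{55}+c_{41}c_{51}^3c_{55}^2+c_{41}c_{42}c_{43}c_{51}^2\\ &-c_{42}c_{45}c_{51}^3+c_{21}c_{41}^2c_{51}c_{52}+3c_{41}c_{45}c_{51}^2c_{52}-3c_{41}c_{43}c_{51}^2c_{54}+c_{45}c_{51}^3c_{54}\\ &+c_{41}c_{42}c_{51}^2c_{55}-3c_{41}^2c_{51}c_{52}c_{55}-3c_{41}c_{51}^2c_{54}c_{55}+c_{22}c_{41}c_{51}-2c_{33}c_{41}c_{51}\\ &+c_{21}^2c_{51}^2-c_{35}c_{51}^2-c_{43}^2c_{51}^2+c_{41}^2c_{42}c_{52}+c_{41}^2c_{52}c_{54}+c_{41}c_{51}c_{54}^2\\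 &-2c_{43}c_{51}^2c_{55}-c_{51}^2c_{55}^2-c_{41}c_{43}c_{52}-c_{45}c_{51}c_{52}+2c_{43}c_{51}c_{54}+c_{41}c_{52}c_{55}\\ &+2c_{51}c_{54}c_{55}+c_{33}-c_{54}^2.\end{aligned}$$
   Context: Let $P=K[x,y]$, $x_1=x$, $x_2=y$, with $t_1=1,t_2=y,t_3=x,t_4=y^2,t_5=x^2$ and $b_1=xy,b_2=y^3,b_3=xy^2,b_4=x^2y,b_5=x^3$. Let $C=(c_{11},c_{12},\dots,c_{55})$ be 25 indeterminates. The generic multiplication matrix $\mathcal{A}_r\in\mathrm{Mat}_5(K[C])$ ($r=1,2$) has $(i,j)$ entry $\delta_{im}$ if $x_rt_j=t_m\in\mathcal{O}$ and $c_{im}$ if $x_rt_j=b_m\in\partial\mathcal{O}$. $I(\mathbb{B}_{\mathcal{O}})$ is the ideal generated by the entries of $\mathcal{A}_1\mathcal{A}_2-\mathcal{A}_2\mathcal{A}_1$, and $B_{\mathcal{O}}=K[C]/I(\mathbb{B}_{\mathcal{O}})$. A tuple $Z=(z_1,\dots,z_s)$ of distinct indeterminates in $C$ is separating for an ideal $I\subseteq K[C]$ if there are $p_1,\dots,p_s\in I$ and a term ordering $\sigma$ on $K[C]$ with $\mathrm{LT}_\sigma(p_i)=z_i$ for all $i$. In this case there are $h_i\in K[C\setminus Z]$ with $z_i-h_i\in I$, and the $Z$-separating re-embedding of $I$ is the $K$-algebra isomorphism $K[C]/I\to K[C\setminus Z]/(I\cap K[C\setminus Z])$ given by $z_i\mapsto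 h_i$ and the identity on $C\setminus Z$. ''Best'' means that $Z$ is separating and no separating tuple for $I(\mathbb{B}_{\mathcal{O}})$ has more entries than $Z$.
   Formalization: That #Z is as large as possible (''best'') is asserted only for char K ≠ 2: in characteristic 2, f_2 = c_33 + g with g free of Z and c_33, so Z together with c_33 is a separating tuple with 14 entries. All other claims are for every perfect K. *)

(* Defs.v *)
From HB Require Import structures.
From mathcomp Require Import all_boot all_order all_algebra all_field.
From mathcomp Require Import boolp mpoly.

Set Implicit Arguments.
Unset Strict Implicit.
Unset Printing Implicit Defensive.

Import GRing.Theory.
Local Open Scope ring_scope.
Local Open Scope quotient_scope.

Definition perfect_field (K : fieldType) : Prop :=
  forall p : {poly K}, irreducible_poly p -> separable_poly p.

(* ring_quotient only gives {ideal_quot I} a ring structure; here it becomes a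
   K-algebra, so that {lrmorphism _ -> _} between quotients is the notion of
   K-algebra homomorphism. *)
Section QuotientAlgebra.
Variables (K : comNzRingType) (A : comAlgType K) (I : idealr A).

Local Notation Q := {ideal_quot I}.
Definition quot_scale (k : K) (x : Q) : Q := \pi_Q (k%:A) * x.

Fact quot_scaleA a b v : quot_scale a (quot_scale b v) = quot_scale (a * b) v.
Proof. by rewrite /quot_scale mulrA -rmorphM /= -scalerAl mul1r scalerA. Qed.
Fact quot_scale1 : left_id 1 quot_scale.
Proof. by move=> v; rewrite /quot_scale scale1r rmorph1 mul1r. Qed.
Fact quot_scaleDr : right_distributive quot_scale +%R.
Proof. by move=> a u v; rewrite /quot_scale mulrDr. Qed.
Fact quot_scaleDl v : {morph quot_scale^~ v : a b / a + b}.
Proof. by move=> a b; rewrite /quot_scale scalerDl rmorphD mulrDl. Qed.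

HB.instance Definition _ := GRing.Zmodule_isLmodule.Build K
  (@Quotient.quot A I) quot_scaleA quot_scale1 quot_scaleDr quot_scaleDl.

Fact quot_scaleAl (a : K) (u v : @Quotient.quot A I) :
  a *: (u * v) = (a *: u) * v.
Proof. exact: mulrA. Qed.

HB.instance Definition _ := GRing.Lmodule_isLalgebra.Build K
  (@Quotient.quot A I) quot_scaleAl.

Lemma pi_quotZ a p : \pi_Q (a *: p) = a *: \pi_Q p.
Proof.
by rewrite -[a *: \pi_Q p]/(\pi_Q (a%:A) * \pi_Q p) -rmorphM mulr_algl.
Qed.
End QuotientAlgebra.

Section IdealSpan.
Variables (R : comNzRingType) (J : finType) (g : J -> R).

Definition ideal_span : {pred R} :=
  fun p => `[< exists a : J -> R, p = \sum_j a j * g j >].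

(* {ideal_quot _} is only available for proper ideals. *)
Lemma ideal_span_closed (S : nzRingType) (ev : {rmorphism R -> S}) :
  (forall j, ev (g j) = 0) -> idealr_closed ideal_span.
Proof.
move=> ev0; split.
- by apply/asboolP; exists (fun=> 0); rewrite big1 // => j _; rewrite mul0r.
- apply/negP => /asboolP[a e1]; have /eqP := rmorph1 ev.
  rewrite e1 rmorph_sum big1 1?eq_sym ?oner_eq0 // => j _.
  by rewrite rmorphM ev0 mulr0.
- move=> a p q /asboolP[u ->] /asboolP[v ->]; apply/asboolP.
  exists (fun j => a * u j + v j); rewrite mulr_sumr -big_split /=.
  by apply: eq_bigr => j _; rewrite mulrDl mulrA.
Qed.
End IdealSpan.

Section Separating.
Variables (n : nat) (K : fieldType).

Definition term_ordering (le : rel 'X_{1..n}) : Prop :=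
  [/\ total le, antisymmetric le, transitive le,
      forall m, le 0%MM m
    & forall m m1 m2, le m1 m2 -> le (m1 + m)%MM (m2 + m)%MM].

Definition is_leading_term (le : rel 'X_{1..n}) (p : {mpoly K[n]})
    (m : 'X_{1..n}) : Prop :=
  m \in msupp p /\ {in msupp p, forall m', le m' m}.

(* A tuple of distinct indeterminates is given by the list of their indices. *)
Definition separating (I : {pred {mpoly K[n]}}) (Z : seq 'I_n) : Prop :=
  uniq Z /\
  exists2 le : rel 'X_{1..n}, term_ordering le &
    {in Z, forall z, exists2 p, p \in I & is_leading_term le p U_(z)%MM}.

Definition best_separating (I : {pred {mpoly K[n]}}) (Z : seq 'I_n) : Prop :=
  separating I Z /\
  forall Z' : seq 'I_n, separating I Z' -> (size Z' <= size Z)%N.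
End Separating.

(* K[C \ Z], as the subalgebra of K[C] of the polynomials in which no
   indeterminate of Z occurs. *)
Section SubPolynomials.
Variables (n : nat) (K : fieldType) (Z : seq 'I_n).

Definition mfree : {pred {mpoly K[n]}} :=
  fun p => all (fun m : 'X_{1..n} => all (fun z => m z == 0%N) Z) (msupp p).

Lemma mfreeP (p : {mpoly K[n]}) :
  reflect {in msupp p, forall m : 'X_{1..n}, {in Z, forall z, m z = 0%N}}
          (p \in mfree).
Proof.
apply: (iffP allP) => h m /h; first by move/allP=> hz z /hz/eqP.
by move=> hz; apply/allP => z /hz ->.
Qed.

Lemma mfree_subalg : subalg_closed mfree.
Proof.
split=> [|a p q /mfreeP hp /mfreeP hq|p q /mfreeP hp /mfreeP hq]; apply/mfreeP.
- by move=> m; rewrite msupp1 inE => /eqP-> z _; rewrite mnm0E.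
- by move=> m /msuppD_le; rewrite mem_cat => /orP[/msuppZ_le/hp|/hq].
move=> m /msuppM_le/allpairsP[[m1 m2] /= [/hp h1 /hq h2 ->]] z zZ.
by rewrite mnmDE h1 ?h2.
Qed.
HB.instance Definition _ := GRing.isSubalgClosed.Build K {mpoly K[n]} mfree
  mfree_subalg.

Record subpoly := Subpoly { subpoly_val : {mpoly K[n]};
                            subpolyP : subpoly_val \in mfree }.
HB.instance Definition _ := [isSub for subpoly_val].
HB.instance Definition _ := [Choice of subpoly by <:].
HB.instance Definition _ := [SubChoice_isSubComNzRing of subpoly by <:].
HB.instance Definition _ := [SubZmodule_isSubLmodule of subpoly by <:].
HB.instance Definition _ := [SubNzRing_SubLmodule_isSubLalgebra of subpoly by <:].
HB.instance Definition _ := [SubLalgebra_isSubAlgebra of subpoly by <:].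

Lemma mfreeX i : i \notin Z -> 'X_i \in mfree.
Proof.
move=> iZ; apply/mfreeP => m; rewrite msuppX inE => /eqP-> z zZ.
by rewrite mnm1E; case: eqP iZ => // ->; rewrite zZ.
Qed.
End SubPolynomials.

(* Phi : K[C]/I -> K[C\Z]/J is the Z-separating re-embedding of I, where J has
   to be the ideal I \cap K[C\Z]. *)
Definition separating_reembedding n (K : fieldType) (I : idealr {mpoly K[n]})
    (Z : seq 'I_n) (J : idealr (subpoly K Z))
    (Phi : {lrmorphism {ideal_quot I} -> {ideal_quot J}}) : Prop :=
  [/\ forall q : subpoly K Z, (q \in J) = (val q \in I),
      exists h : 'I_n -> subpoly K Z, {in Z, forall z,
        'X_z - val (h z) \in I /\
        Phi (\pi_({ideal_quot I}) 'X_z) = \pi_({ideal_quot J}) (h z)},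
      forall q : subpoly K Z,
        Phi (\pi_({ideal_quot I}) (val q)) = \pi_({ideal_quot J}) q
    & bijective Phi].

Section LShape.

(* Terms of K[x, y], with x of index 0 and y of index 1. *)
Local Notation tx := (U_(@ord0 1))%MM.
Local Notation ty := (U_(@ord_max 1))%MM.

Definition L_ideal : 5.-tuple 'X_{1..2} :=
  [tuple 0%MM; ty; tx; (ty *+ 2)%MM; (tx *+ 2)%MM].
Definition L_border : 5.-tuple 'X_{1..2} :=
  [tuple (tx + ty)%MM; (ty *+ 3)%MM; (tx + ty *+ 2)%MM;
         (tx *+ 2 + ty)%MM; (tx *+ 3)%MM].

(* c_{ij}, 1 <= i, j <= 5, listed row by row. *)
Definition cidx (i j : nat) : 'I_25 := inord (5 * i.-1 + j.-1).

Definition LZ : seq 'I_25 :=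
  [:: cidx 1 1; cidx 1 2; cidx 1 3; cidx 1 4; cidx 1 5;
      cidx 2 3; cidx 2 4; cidx 2 5; cidx 3 1; cidx 3 2; cidx 3 4;
      cidx 4 4; cidx 5 3].

Variable K : fieldType.

Definition cvar (i j : nat) : {mpoly K[25]} := 'X_(cidx i j).
Local Notation c := cvar.

(* Every x_r t_j lies in the order ideal or in its border, so that the index
   below is always < 5; the 0-based indices are shifted to those of c. *)
Definition gen_mult_mx (r : 'I_2) : 'M[{mpoly K[25]}]_5 :=
  \matrix_(i, j)
    let u := (U_(r) + tnth L_ideal j)%MM in
    if u \in L_ideal then (u == tnth L_ideal i)%:R
    else c i.+1 (index u L_border).+1.

Definition border_commutator : 'M[{mpoly K[25]}]_5 :=
  gen_mult_mx ord0 *m gen_mult_mx ord_max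
  - gen_mult_mx ord_max *m gen_mult_mx ord0.

Definition border_ideal : {pred {mpoly K[25]}} :=
  ideal_span (fun ij : 'I_5 * 'I_5 => border_commutator ij.1 ij.2).

Definition Lf1 : {mpoly K[25]} :=
  c 2 1 * c 4 1 ^+ 2 * c 5 1 ^+ 2 + c 4 1 ^+ 2 * c 4 3 * c 5 1 ^+ 2
  + c 4 1 * c 4 5 * c 5 1 ^+ 3 + c 4 1 ^+ 2 * c 4 2 * c 5 1
  - c 4 1 ^+ 3 * c 5 2 - c 4 1 ^+ 2 * c 5 1 * c 5 4
  + c 2 1 * c 4 1 * c 5 1 + c 4 5 * c 5 1 ^+ 2 - c 4 1 * c 5 1 * c 5 5
  + c 4 1 * c 4 2 + c 4 1 * c 5 4 + c 2 1 - c 4 3.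

(* In characteristic 2 the indeterminate c 3 3 occurs in Lf2 only as a linear
   term; then also c 3 3 :: LZ is separating for border_ideal, and LZ is no
   longer a separating tuple of maximal size. *)
Definition Lf2 : {mpoly K[25]} :=
  - c 2 1 ^+ 2 * c 4 1 ^+ 3 * c 5 1 ^+ 5
  - 2%:R * c 2 1 * c 4 1 ^+ 3 * c 4 3 * c 5 1 ^+ 5
  - c 4 1 ^+ 3 * c 4 3 ^+ 2 * c 5 1 ^+ 5
  - 2%:R * c 2 1 * c 4 1 ^+ 2 * c 4 5 * c 5 1 ^+ 6
  - 2%:R * c 4 1 ^+ 2 * c 4 3 * c 4 5 * c 5 1 ^+ 6
  - c 4 1 * c 4 5 ^+ 2 * c 5 1 ^+ 7
  - c 2 1 * c 4 1 ^+ 3 * c 4 2 * c 5 1 ^+ 4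
  - c 4 1 ^+ 3 * c 4 2 * c 4 3 * c 5 1 ^+ 4
  - c 4 1 ^+ 2 * c 4 2 * c 4 5 * c 5 1 ^+ 5
  + c 2 1 * c 4 1 ^+ 3 * c 5 1 ^+ 4 * c 5 4
  + c 4 1 ^+ 3 * c 4 3 * c 5 1 ^+ 4 * c 5 4
  + c 4 1 ^+ 2 * c 4 5 * c 5 1 ^+ 5 * c 5 4
  - c 4 1 ^+ 4 * c 4 2 * c 5 1 ^+ 2 * c 5 2
  + c 4 1 ^+ 5 * c 5 1 * c 5 2 ^+ 2
  + c 4 1 ^+ 4 * c 5 1 ^+ 2 * c 5 2 * c 5 4
  - c 4 1 ^+ 2 * c 4 2 * c 4 3 * c 5 1 ^+ 3
  - c 2 1 * c 4 1 ^+ 3 * c 5 1 ^+ 2 * c 5 2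
  + c 4 1 ^+ 3 * c 4 3 * c 5 1 ^+ 2 * c 5 2
  - c 4 1 ^+ 2 * c 4 5 * c 5 1 ^+ 3 * c 5 2
  - 2%:R * c 2 1 * c 4 1 ^+ 2 * c 5 1 ^+ 3 * c 5 4
  - c 4 1 ^+ 2 * c 4 3 * c 5 1 ^+ 3 * c 5 4
  - 2%:R * c 4 1 * c 4 5 * c 5 1 ^+ 4 * c 5 4
  - c 4 1 ^+ 2 * c 4 2 * c 5 1 ^+ 3 * c 5 5
  + 2%:R * c 4 1 ^+ 3 * c 5 1 ^+ 2 * c 5 2 * c 5 5
  + c 4 1 ^+ 2 * c 5 1 ^+ 3 * c 5 4 * c 5 5
  + 2%:R * c 2 1 * c 4 1 * c 4 3 * c 5 1 ^+ 3
  + 3%:R * c 4 1 * c 4 3 ^+ 2 * c 5 1 ^+ 3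
  + 2%:R * c 4 3 * c 4 5 * c 5 1 ^+ 4 - c 4 1 ^+ 4 * c 5 2 ^+ 2
  - 2%:R * c 4 1 ^+ 3 * c 5 1 * c 5 2 * c 5 4
  + 2%:R * c 4 1 * c 4 3 * c 5 1 ^+ 3 * c 5 5
  + c 4 1 * c 5 1 ^+ 3 * c 5 5 ^+ 2 + c 4 1 * c 4 2 * c 4 3 * c 5 1 ^+ 2
  - c 4 2 * c 4 5 * c 5 1 ^+ 3 + c 2 1 * c 4 1 ^+ 2 * c 5 1 * c 5 2
  + 3%:R * c 4 1 * c 4 5 * c 5 1 ^+ 2 * c 5 2
  - 3%:R * c 4 1 * c 4 3 * c 5 1 ^+ 2 * c 5 4 + c 4 5 * c 5 1 ^+ 3 * c 5 4
  + c 4 1 * c 4 2 * c 5 1 ^+ 2 * c 5 5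
  - 3%:R * c 4 1 ^+ 2 * c 5 1 * c 5 2 * c 5 5
  - 3%:R * c 4 1 * c 5 1 ^+ 2 * c 5 4 * c 5 5 + c 2 2 * c 4 1 * c 5 1
  - 2%:R * c 3 3 * c 4 1 * c 5 1 + c 2 1 ^+ 2 * c 5 1 ^+ 2
  - c 3 5 * c 5 1 ^+ 2 - c 4 3 ^+ 2 * c 5 1 ^+ 2
  + c 4 1 ^+ 2 * c 4 2 * c 5 2 + c 4 1 ^+ 2 * c 5 2 * c 5 4
  + c 4 1 * c 5 1 * c 5 4 ^+ 2 - 2%:R * c 4 3 * c 5 1 ^+ 2 * c 5 5
  - c 5 1 ^+ 2 * c 5 5 ^+ 2 - c 4 1 * c 4 3 * c 5 2
  - c 4 5 * c 5 1 * c 5 2 + 2%:R * c 4 3 * c 5 1 * c 5 4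
  + c 4 1 * c 5 2 * c 5 5 + 2%:R * c 5 1 * c 5 4 * c 5 5 + c 3 3
  - c 5 4 ^+ 2.

Section Origin.
Variables (S : nzRingType) (ev : {rmorphism {mpoly K[25]} -> S}).
Hypothesis evc : forall i j, ev (c i j) = 0.

Local Fact evM r i j : ev (gen_mult_mx r i j) =
  ((U_(r) + tnth L_ideal j)%MM == tnth L_ideal i)%:R.
Proof.
rewrite mxE; cbv zeta; set u := (U_(r) + _)%MM.
case: ifP => [_|uL]; first by rewrite rmorph_nat.
by rewrite evc; case: eqP uL => // ->; rewrite mem_tnth.
Qed.

Local Fact L_ideal_xy i :
  (tnth L_ideal i) ord0 = 0%N \/ (tnth L_ideal i) ord_max = 0%N.
Proof.
case: i => [[|[|[|[|[]]]]]] //= ?; rewrite (tnth_nth 0%MM) /=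
  ?mnm0E ?mulmnE ?mnm1E /=; by [left|right].
Qed.

Local Fact evMM r s i j : r != s ->
  ev ((gen_mult_mx r *m gen_mult_mx s) i j) = 0.
Proof.
move=> rs; rewrite mxE rmorph_sum big1 // => k _; rewrite rmorphM !evM.
case: eqP => [Ei|_]; last by rewrite mul0r.
case: eqP => [Ek|_]; last by rewrite mulr0.
have := L_ideal_xy i; rewrite -Ei -Ek !mnmDE !mnm1E {Ei Ek}.
by case: r s rs => [[|[|[]]] ?] // [[|[|[]]] ?] //= _ [].
Qed.

Local Fact ev_commutator i j : ev (border_commutator i j) = 0.
Proof.
have subE (A B : 'M[{mpoly K[25]}]_5) : (A - B) i j = A i j - B i j.
  by rewrite !mxE.
rewrite /border_commutator subE rmorphB.
apply: etrans (congr2 (fun a b => a - b) (evMM _ _ _) (evMM _ _ _)) _ => //.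
exact: subrr.
Qed.

Lemma border_ideal_closed_of : idealr_closed border_ideal.
Proof.
by apply: (@ideal_span_closed _ _ _ _ ev) => -[i j]; apply: ev_commutator.
Qed.

Local Fact evXc i j k : ev (c i j ^+ k.+1) = 0.
Proof. by rewrite rmorphXn /= evc expr0n. Qed.

Local Fact evD p q : ev p = 0 -> ev q = 0 -> ev (p + q) = 0.
Proof. by move=> p0 q0; rewrite rmorphD /= p0 q0 addr0. Qed.
Local Fact evN p : ev p = 0 -> ev (- p) = 0.
Proof. by move=> p0; rewrite rmorphN /= p0 oppr0. Qed.
Local Fact evMr p q : ev q = 0 -> ev (p * q) = 0.
Proof. by move=> q0; rewrite rmorphM /= q0 mulr0. Qed.

Ltac ev_tac :=
  repeat match goal with
  | |- _ = _ => first [ simple apply evc | simple apply evXc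
      | simple apply evMr | simple apply evN | simple apply evD ]
  end.

Lemma ev_Lf1 : ev Lf1 = 0. Proof. rewrite /Lf1; ev_tac. Qed.
Lemma ev_Lf2 : ev Lf2 = 0. Proof. rewrite /Lf2; ev_tac. Qed.
End Origin.

Local Definition ev0 : {rmorphism {mpoly K[25]} -> K} := meval (fun=> 0).

Local Fact ev0c i j : ev0 (c i j) = 0. Proof. exact: mevalXU. Qed.

Lemma border_idealr_closed : idealr_closed border_ideal.
Proof. exact: border_ideal_closed_of ev0c. Qed.
HB.instance Definition _ :=
  isIdealr.Build {mpoly K[25]} border_ideal border_idealr_closed.

Definition border_ring := {ideal_quot border_ideal}.

Local Fact cfree i j (k := (5 * i.-1 + j.-1)%N) :
  (k < 25)%N && (k \notin [:: 0; 1; 2; 3; 4; 7; 8; 9; 10; 11; 13; 18; 22])%N ->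
  c i j \in mfree LZ.
Proof.
case/andP=> k25 kZ; apply: mfreeX; apply: contra kZ => /(map_f val).
by rewrite /= !inordK.
Qed.

Ltac free_tac :=
  repeat match goal with
  | |- is_true (_ + _ \in _) => apply: rpredD
  | |- is_true (- _ \in _) => rewrite rpredN
  | |- is_true (_ * _ \in _) => apply: rpredM
  | |- is_true (_ ^+ _ \in _) => apply: rpredX
  | |- is_true (_%:R \in _) => apply: rpred_nat
  | |- is_true (c _ _ \in _) => by apply: cfree
  end.

Lemma Lf1_free : Lf1 \in mfree LZ. Proof. by rewrite /Lf1; free_tac. Qed.
Lemma Lf2_free : Lf2 \in mfree LZ. Proof. by rewrite /Lf2; free_tac. Qed.

Definition Lf_ideal : {pred subpoly K LZ} :=
  ideal_span (fun b : bool => if b then Subpoly Lf1_free else Subpoly Lf2_free).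

Lemma Lf_idealr_closed : idealr_closed Lf_ideal.
Proof.
apply: (@ideal_span_closed _ _ _ _ (ev0 \o val)).
by case; [apply: (ev_Lf1 ev0c) | apply: (ev_Lf2 ev0c)].
Qed.
HB.instance Definition _ :=
  isIdealr.Build (subpoly K LZ) Lf_ideal Lf_idealr_closed.

End LShape.

Arguments border_ideal : clear implicits.
Arguments Lf_ideal : clear implicits.

(* Main.v *)
Require Import Defs.
From HB Require Import structures.
From mathcomp Require Import all_boot all_order all_algebra all_field.
From mathcomp Require Import boolp mpoly.
From mathcomp Require Import ring zify.

Set Implicit Arguments.
Unset Strict Implicit.
Unset Printing Implicit Defensive.

Import GRing.Theory.
Local Open Scope ring_scope.

(** A point of the border basis scheme with coordinates in a commutative ring R
is a table c of elements of R for which the two generic multiplication matrices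
X and Y commute. Most of the sixteen equations in the rows below the first one
are solved for an indeterminate of Z at sight. Two pairs of them are circular:
they give c53 and c31 in terms of each other, and likewise c25 and c24. Write
u = c41 c51. The circles are broken by substituting around them and using one
more equation, which prescribes c41 c31, respectively c51^2 c24. For instance
the equations give c24 = P + u c24 and c51^2 c24 = Q with P and Q free of c24,
whence c24 = P + u (P + u c24) = (1 + u) P + c41^2 Q. The two equations that are
left are c41 c31 - (the prescribed value) = 0 and c51^2 P - (1 - u) Q = 0, and
expanding them gives f1 and f2. The first row of the commutator then vanishes
because traces of the form tr ([X, Y] W) vanish when W commutes with X or Y.

So over every R the commuting tables are the tables in which the entries of Z
have their solved value and f1 = f2 = 0 ([solved_of_commuting],
[commuting_of_solved]). Reading this in R = K[C]/I yields z - h_z in I and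
f1, f2 in I; reading it in R = K[C \ Z]/(f1, f2) shows that the substitution
z |-> h_z sends I into (f1, f2). The two induced maps of quotient rings are
inverse to each other, and Z is separating for any term ordering that compares
first the degree in Z.

For the maximality, let Z' be separating. Going up along the term ordering, the
coordinates in Z' of a point of the scheme are determined by its other
coordinates ([separating_determines]). Therefore Z' cannot contain the whole set
of coordinates in which two points differ. Two points are compared on each
coordinate axis used below; the other pairs differ in the sign of a parameter t,
taken to be 1 and -1, which are distinct outside characteristic 2. They show
that Z' misses
- c22, c35, c41, c42, c45, c51, c52 and c55 (coordinate axes);
- one of each of the pairs {c21, c43}, {c31, c54}, {c43, c44}, {c53, c54};
- one of {c23, c24, c25, c32, c33, c34}: at u = 1/2 the equation f2 = 0 is free
  of c33;
- one of {c21, c31, c12, c15, c44, c53}: if u is a primitive cube root of unity,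
  f1 = 0 is free of c21.
A count gives at least 12 missed indeterminates out of 25. *)

(* The indices of a table are natural numbers, whatever the ambient scope. *)
Local Notation "c .[ i , j ]" := (c i%N j%N)
  (at level 1, left associativity, only parsing) : ring_scope.

(** * The commutator equations over a commutative ring *)

Section Equations.
Variable R : comNzRingType.
Implicit Type c : nat -> nat -> R.

(** Rows and columns of the multiplication matrices are numbered from 0, the
entries of a table c from 1. *)
Definition mulX c (i j : nat) : R :=
  match j with
  | 0%N => (i == 2)%:R | 1%N => c i.+1 1%N | 2%N => (i == 4)%:R
  | 3%N => c i.+1 3%N | _ => c i.+1 5%N
  end.

Definition mulY c (i j : nat) : R :=
  match j with
  | 0%N => (i == 1)%:R | 1%N => (i == 3)%:R | 2%N => c i.+1 1%N
  | 3%N => c i.+1 2%N | _ => c i.+1 4%N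
  end.

Definition bracket c (i j : nat) : R :=
  \sum_(k < 5) mulX c i k * mulY c k j - \sum_(k < 5) mulY c i k * mulX c k j.

Definition commuting c :=
  forall i j, (i < 5)%N -> (j < 5)%N -> bracket c i j = 0.

Lemma bracketE c i j : bracket c i j =
  mulX c i 0 * mulY c 0 j + mulX c i 1 * mulY c 1 j + mulX c i 2 * mulY c 2 j
  + mulX c i 3 * mulY c 3 j + mulX c i 4 * mulY c 4 j
  - (mulY c i 0 * mulX c 0 j + mulY c i 1 * mulX c 1 j + mulY c i 2 * mulX c 2 j
     + mulY c i 3 * mulX c 3 j + mulY c i 4 * mulX c 4 j).
Proof. by rewrite /bracket !big_ord_recr !big_ord0 /= !add0r. Qed.

(** On the scheme this is c41 c31, by the entry (3, 1) of the commutator. *)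
Definition prod3141 c : R :=
  c.[4, 3] - c.[2, 1] - c.[4, 1] * c.[4, 2] - c.[4, 4] * c.[5, 1].

(** On the scheme c25 = c24 c41 + tail25 and c34 = tail34 - c24 c51. *)
Definition tail25 c : R :=
  c.[4, 3] * c.[4, 4] + c.[4, 5] * c.[5, 4] - c.[3, 5] * c.[4, 1]
  - c.[4, 2] * c.[4, 5] - c.[4, 4] * c.[5, 5].

Definition tail34 c : R :=
  c.[3, 5] * c.[5, 1] + c.[4, 5] * c.[5, 2] - c.[4, 4] * c.[5, 3].

(** On the scheme P24 = (1 - c41 c51) c24 and Q24 = c51^2 c24. *)
Definition P24 c : R :=
  c.[2, 1] ^+ 2 + c.[2, 3] * c.[4, 1] + c.[5, 1] * tail25 c.

Definition Q24 c : R :=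
  c.[3, 1] ^+ 2 + c.[3, 2] * c.[4, 1] + c.[5, 1] * tail34 c - c.[3, 3].

(** The two equations that remain; they become the polynomials f1 and f2 once
the solved entries are substituted. *)
Definition F1 c : R := c.[4, 1] * c.[3, 1] - prod3141 c.

Definition F2 c : R :=
  c.[5, 1] ^+ 2 * P24 c - (1 - c.[4, 1] * c.[5, 1]) * Q24 c.

(** One substitution step: each entry of Z is expressed by entries that come
before it in the order given by [depth] below. *)
Definition solve c (i j : nat) : R :=
  match i, j with
  | 4%N, 4%N => c.[2, 1] * c.[4, 1] + c.[4, 1] * c.[4, 3] + c.[4, 5] * c.[5, 1]
  | 3%N, 1%N => c.[5, 4] - c.[2, 1] * c.[5, 1] - c.[5, 1] * c.[5, 5]
      - (c.[5, 1] * prod3141 c + c.[4, 1] ^+ 2 * c.[5, 2]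
         + c.[4, 1] * c.[5, 1] * c.[5, 4])
  | 5%N, 3%N => c.[3, 1] * c.[5, 1] + c.[4, 1] * c.[5, 2] + c.[5, 1] * c.[5, 4]
  | 2%N, 3%N => c.[2, 2] * c.[4, 1] - c.[3, 3] * c.[4, 1] - c.[4, 4] * c.[5, 3]
      + c.[4, 5] * c.[5, 2]
  | 3%N, 2%N => c.[3, 3] * c.[5, 1] - c.[2, 2] * c.[5, 1] - c.[4, 2] * c.[5, 3]
      + c.[4, 3] * c.[5, 2] - c.[5, 2] * c.[5, 5] + c.[5, 3] * c.[5, 4]
  | 2%N, 4%N => (1 + c.[4, 1] * c.[5, 1]) * P24 c + c.[4, 1] ^+ 2 * Q24 c
  | 2%N, 5%N => c.[2, 4] * c.[4, 1] + tail25 c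
  | 3%N, 4%N => tail34 c - c.[2, 4] * c.[5, 1]
  | 1%N, 1%N => c.[2, 3] - c.[2, 1] * c.[3, 1] - c.[2, 2] * c.[4, 1]
      - c.[2, 4] * c.[5, 1]
  | 1%N, 2%N => c.[3, 1] * c.[3, 3] - c.[2, 2] * c.[3, 1] + c.[3, 2] * c.[4, 3]
      - c.[3, 3] * c.[4, 2] + c.[3, 4] * c.[5, 3] - c.[3, 5] * c.[5, 2]
  | 1%N, 3%N => c.[2, 1] * c.[2, 2] - c.[2, 1] * c.[3, 3] - c.[2, 2] * c.[4, 3]
      + c.[2, 3] * c.[4, 2] - c.[2, 4] * c.[5, 3] + c.[2, 5] * c.[5, 2]
  | 1%N, 4%N => c.[3, 1] * c.[3, 5] - c.[2, 4] * c.[3, 1] + c.[3, 2] * c.[4, 5]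
      - c.[3, 3] * c.[4, 4] + c.[3, 4] * c.[5, 5] - c.[3, 5] * c.[5, 4]
  | 1%N, 5%N => c.[2, 1] * c.[2, 4] - c.[2, 1] * c.[3, 5] - c.[2, 2] * c.[4, 5]
      + c.[2, 3] * c.[4, 4] - c.[2, 4] * c.[5, 5] + c.[2, 5] * c.[5, 4]
  | _, _ => c i j
  end.

Definition solved c := forall i j, c i j = solve c i j.

Ltac expand_brackets := rewrite !bracketE /=; ring.

Lemma solved_of_commuting c :
  commuting c -> [/\ solved c, F1 c = 0 & F2 c = 0].
Proof.
move=> com; pose E i j := bracket c i j; pose u := c.[4, 1] * c.[5, 1].
have E0 i j : (i < 5)%N -> (j < 5)%N -> E i j = 0 by apply: com.
have solve_eq i j e : c i j - solve c i j = e -> e = 0 -> c i j = solve c i j.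
  by move=> <- /eqP; rewrite subr_eq0 => /eqP.
suff sol : solved c.
  split=> //.
    transitivity (- E.[3, 1]); last by rewrite E0 ?oppr0.
    by rewrite /E /F1 /prod3141; expand_brackets.
  (* E12 + c51 E34 = P24 - (1 - u) c24 and E21 + c51 E44 = c51^2 c24 - Q24;
     c24 cancels in the combination below. *)
  transitivity (c.[5, 1] ^+ 2 * (E.[1, 2] + c.[5, 1] * E.[3, 4])
    + (1 - u) * (E.[2, 1] + c.[5, 1] * E.[4, 4])); last by rewrite !E0 //; ring.
  by rewrite /E /u /F2 /P24 /Q24 /tail25 /tail34; expand_brackets.
have s44 : c.[4, 4] = solve c 4 4.
  apply: (solve_eq _ _ (- E.[3, 2])); last by rewrite E0 ?oppr0.
  by rewrite /E /=; expand_brackets.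
have s53 : c.[5, 3] = solve c 5 3.
  apply: (solve_eq _ _ (E.[4, 1])); last by rewrite E0.
  by rewrite /E /=; expand_brackets.
have s31 : c.[3, 1] = solve c 3 1.
  (* E42 solves for c31 with c53 on the right; E41 eliminates c53 and E31 the
     product c41 c31 which this brings back. *)
  apply: (solve_eq _ _ (E.[4, 2] - c.[4, 1] * E.[4, 1] + c.[5, 1] * E.[3, 1])).
    by rewrite /E /= /prod3141; expand_brackets.
  by rewrite !E0 //; ring.
have s23 : c.[2, 3] = solve c 2 3.
  apply: (solve_eq _ _ (- E.[3, 3])); last by rewrite E0 ?oppr0.
  by rewrite /E /=; expand_brackets.
have s32 : c.[3, 2] = solve c 3 2.
  apply: (solve_eq _ _ (E.[4, 3])); last by rewrite E0.
  by rewrite /E /=; expand_brackets.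
have s24 : c.[2, 4] = solve c 2 4.
  (* (1 + u) P24 + c41^2 Q24 = (1 - u^2) c24 + u^2 c24 *)
  apply: (solve_eq _ _ (c.[4, 1] ^+ 2 * (E.[2, 1] + c.[5, 1] * E.[4, 4])
     - (1 + u) * (E.[1, 2] + c.[5, 1] * E.[3, 4]))).
    by rewrite /E /= /u /P24 /Q24 /tail25 /tail34; expand_brackets.
  by rewrite !E0 //; ring.
have s25 : c.[2, 5] = solve c 2 5.
  apply: (solve_eq _ _ (- E.[3, 4])); last by rewrite E0 ?oppr0.
  by rewrite /E /= /tail25; expand_brackets.
have s34 : c.[3, 4] = solve c 3 4.
  apply: (solve_eq _ _ (E.[4, 4])); last by rewrite E0.
  by rewrite /E /= /tail34; expand_brackets.
have s11 : c.[1, 1] = solve c 1 1.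
  apply: (solve_eq _ _ (- E.[1, 1])); last by rewrite E0 ?oppr0.
  by rewrite /E /=; expand_brackets.
have s12 : c.[1, 2] = solve c 1 2.
  apply: (solve_eq _ _ (E.[2, 3])); last by rewrite E0.
  by rewrite /E /=; expand_brackets.
have s13 : c.[1, 3] = solve c 1 3.
  apply: (solve_eq _ _ (- E.[1, 3])); last by rewrite E0 ?oppr0.
  by rewrite /E /=; expand_brackets.
have s14 : c.[1, 4] = solve c 1 4.
  apply: (solve_eq _ _ (E.[2, 4])); last by rewrite E0.
  by rewrite /E /=; expand_brackets.
have s15 : c.[1, 5] = solve c 1 5.
  apply: (solve_eq _ _ (- E.[1, 4])); last by rewrite E0 ?oppr0.
  by rewrite /E /=; expand_brackets.
by do 6![case=> [|]; try by do 6![case=> [|]; try by []]].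
Qed.

Definition mxX c : 'M[R]_5 := \matrix_(i, j) mulX c i j.
Definition mxY c : 'M[R]_5 := \matrix_(i, j) mulY c i j.
Definition mxbracket c : 'M[R]_5 := mxX c *m mxY c - mxY c *m mxX c.

Lemma mxbracketE c (i j : 'I_5) : mxbracket c i j = bracket c i j.
Proof.
rewrite /mxbracket /bracket ![in LHS]mxE; congr (_ - _);
by apply: eq_bigr => k _; rewrite !mxE.
Qed.

Lemma tr_commutator_mul n (A B W : 'M[R]_n) : W *m A = A *m W ->
  \tr ((A *m B - B *m A) *m W) = 0.
Proof.
move=> WA.
by rewrite mulmxBl raddfB /= -!mulmxA -WA mxtrace_mulC -mulmxA subrr.
Qed.

(** If only the first row of [X, Y] is nonzero, the trace of [X, Y] W is the
product of that row with the first column of W. Taking W among X, Y, X^2, Y^2,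
whose first columns represent x, y, x^2 and y^2, isolates each entry. *)
Lemma commuting_row0 c :
  (forall i j, (0 < i < 5)%N -> (j < 5)%N -> bracket c i j = 0) -> commuting c.
Proof.
move=> rows; pose e0 : 'I_5 := ord0.
have row0 (W : 'M_5) (k : 'I_5) : (forall j, W j e0 = (j == k)%:R) ->
    W *m mxX c = mxX c *m W \/ W *m mxY c = mxY c *m W -> bracket c 0 k = 0.
  move=> We0 comW; have : \tr (mxbracket c *m W) = 0.
    case: comW => comW; first exact: tr_commutator_mul.
    by rewrite -[mxbracket c]opprB mulNmx raddfN /= tr_commutator_mul ?oppr0.
  rewrite /mxtrace (bigD1 e0) //= [X in _ + X]big1 ?addr0 => [|i i0].
    rewrite mxE (bigD1 k) //= big1 ?addr0 => [|j jk].
      by rewrite We0 eqxx mulr1 mxbracketE.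
    by rewrite We0 (negPf jk) mulr0.
  rewrite mxE big1 // => j _; rewrite mxbracketE rows ?mul0r //.
  by rewrite lt0n i0 ltn_ord.
have mul_e0 (A B : 'M[R]_5) (k : 'I_5) j : (forall j, A j e0 = (j == k)%:R) ->
  (B *m A) j e0 = B j k.
  move=> A0; rewrite mxE (bigD1 k) //= A0 eqxx mulr1 big1 ?addr0 // => i ik.
  by rewrite A0 (negPf ik) mulr0.
have X0 j : mxX c j e0 = (j == inord 2)%:R.
  by rewrite mxE -val_eqE /= inordK.
have Y0 j : mxY c j e0 = (j == inord 1)%:R.
  by rewrite mxE -val_eqE /= inordK.
move=> [|i] [|[|[|[|[|j]]]]] // i5 _; try exact: rows.
- by rewrite bracketE /=; ring.
- by have /= := row0 _ _ Y0 (or_intror erefl); rewrite inordK.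
- by have /= := row0 _ _ X0 (or_introl erefl); rewrite inordK.
- have /row0 : forall j, (mxY c *m mxY c) j e0 = (j == inord 3)%:R.
    by move=> j; rewrite (mul_e0 _ _ _ _ Y0) mxE -!val_eqE /= !inordK.
  by rewrite inordK // => -> //; right; rewrite mulmxA.
- have /row0 : forall j, (mxX c *m mxX c) j e0 = (j == inord 4)%:R.
    by move=> j; rewrite (mul_e0 _ _ _ _ X0) mxE -!val_eqE /= !inordK.
  by rewrite inordK // => -> //; left; rewrite mulmxA.
Qed.

Lemma commuting_of_solved c :
  solved c -> F1 c = 0 -> F2 c = 0 -> commuting c.
Proof.
move=> sol f1 f2; apply: commuting_row0.
pose d i j := c i j - solve c i j; pose u := c.[4, 1] * c.[5, 1].
have d0 i j : d i j = 0 by rewrite /d -sol subrr.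
move=> [|[|[|[|[|i]]]]] [|[|[|[|[|j]]]]] // _ _.
(* The entries of the first column vanish identically. *)
all: try by rewrite bracketE /=; ring.
all: pose vanish := (f1, f2, d0, mulr0, oppr0, addr0, subr0).
all: match goal with
  | |- bracket _ 1 1 = 0 => transitivity (- d.[1, 1])
  | |- bracket _ 1 2 = 0 => transitivity
      (c.[4, 1] ^+ 2 * F2 c - (1 - u) * d.[2, 4] + c.[5, 1] * d.[2, 5])
  | |- bracket _ 1 3 = 0 => transitivity (- d.[1, 3])
  | |- bracket _ 1 4 = 0 => transitivity (- d.[1, 5])
  | |- bracket _ 2 1 = 0 => transitivity
      ((1 + u) * F2 c + c.[5, 1] ^+ 2 * d.[2, 4] - c.[5, 1] * d.[3, 4])
  | |- bracket _ 2 2 = 0 => transitivity (d.[1, 1] + d.[2, 3] - d.[3, 4])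
  | |- bracket _ 2 3 = 0 => transitivity (d.[1, 2])
  | |- bracket _ 2 4 = 0 => transitivity (d.[1, 4])
  | |- bracket _ 3 1 = 0 => transitivity (- F1 c)
  | |- bracket _ 3 2 = 0 => transitivity (- d.[4, 4])
  | |- bracket _ 3 3 = 0 => transitivity (- d.[2, 3])
  | |- bracket _ 3 4 = 0 => transitivity (- d.[2, 5])
  | |- bracket _ 4 1 = 0 => transitivity (d.[5, 3])
  | |- bracket _ 4 2 = 0 => transitivity
      (d.[3, 1] + c.[4, 1] * d.[5, 3] + c.[5, 1] * F1 c)
  | |- bracket _ 4 3 = 0 => transitivity (d.[3, 2])
  | |- bracket _ 4 4 = 0 => transitivity (d.[3, 4])
  end; last by rewrite !vanish.
all: rewrite /d /= /F1 /F2 /u /P24 /Q24 /tail25 /tail34 /prod3141.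
all: by expand_brackets.
Qed.

(** The order of elimination: 0 outside Z, positive on Z. The value 8 is given to
the index pairs outside the range of c11, ..., c55, whose entries no equation
reads. *)
Definition depth (i j : nat) : nat :=
  match i, j with
  | 2, 1 | 2, 2 | 3, 3 | 3, 5 | 4, 1 | 4, 2 | 4, 3 | 4, 5
  | 5, 1 | 5, 2 | 5, 4 | 5, 5 => 0
  | 4, 4 => 1 | 3, 1 => 2 | 5, 3 => 3 | 2, 3 | 3, 2 => 4 | 2, 4 => 5
  | 2, 5 | 3, 4 | 1, 1 => 6 | 1, 2 | 1, 3 | 1, 4 | 1, 5 => 7
  | _, _ => 8
  end%N.

Lemma commuting_eq c c' :
  (forall i j, (depth i j <= 7)%N -> c i j = c' i j) ->
  commuting c -> commuting c'.
Proof.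
move=> eqc com i j i5 j5; rewrite -(com i j i5 j5) /bracket.
have eX k l : (k < 5)%N -> mulX c k l = mulX c' k l.
  by case: k => [|[|[|[|[|k]]]]] //; case: l => [|[|[|[|l]]]] //= _; rewrite eqc.
have eY k l : (k < 5)%N -> mulY c k l = mulY c' k l.
  by case: k => [|[|[|[|[|k]]]]] //; case: l => [|[|[|[|l]]]] //= _; rewrite eqc.
by congr (_ - _); apply: eq_bigr => k _; rewrite eX ?eY.
Qed.

Lemma solve_default c i j :
  (depth i j == 0%N) || (7 < depth i j)%N -> solve c i j = c i j.
Proof. by move: i j => [|[|[|[|[|[|i]]]]]] [|[|[|[|[|[|j]]]]]]. Qed.

(** The system [solve] is triangular for [depth]. *)
Lemma solve_local n c c' : (n < 7)%N ->
  (forall i j, (depth i j <= n)%N -> c i j = c' i j) ->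
  forall i j, (depth i j <= n.+1)%N -> solve c i j = solve c' i j.
Proof.
move=> n7 eq_c i j dn; move: dn (leq_trans dn n7).
by move: i j => [|[|[|[|[|[|i]]]]]] [|[|[|[|[|[|j]]]]]] //= dn d7;
  rewrite /= /prod3141 /P24 /Q24 /tail25 /tail34 !eq_c //; rewrite -ltnS;
  apply: leq_trans dn.
Qed.

Lemma iter_solve_stable c n i j : (n <= 7)%N -> (depth i j <= n)%N ->
  iter n solve c i j = solve (iter n solve c) i j.
Proof.
elim: n i j => [|n IHn] i j n7 dn.
  by rewrite solve_default // -leqn0 dn.
by rewrite iterS; apply: solve_local dn => // k l; apply: IHn; apply: ltnW.
Qed.

(** Existence is all that is retained of this construction: by [solved_eq] the
equations determine the table, whereas the nested substitutions would be
expensive to unfold. *)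
Lemma solved_extension c :
  {x | solved x & forall i j, depth i j = 0%N -> x i j = c i j}.
Proof.
exists (iter 7 solve c) => i j.
  case: (leqP (depth i j) 7) => dij; first exact: iter_solve_stable dij.
  by rewrite solve_default // dij orbT.
by move=> d0; rewrite !iterS !solve_default ?d0.
Qed.

Lemma solved_eq c c' : solved c -> solved c' ->
  (forall i j, depth i j = 0%N -> c i j = c' i j) ->
  forall i j, (depth i j <= 7)%N -> c i j = c' i j.
Proof.
move=> sc sc' free i j; have: (7 <= 7)%N by [].
elim: {1 3}7%N i j => [|n IHn] i j n7 dn.
  by apply: free; apply/eqP; rewrite -leqn0.
by rewrite sc sc'; apply: solve_local dn => // k l; apply: IHn; apply: ltnW.
Qed.
End Equations.

Section Naturality.
Variables (R S : comNzRingType) (phi : {rmorphism R -> S}).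
Implicit Types c : nat -> nat -> R.

Definition image_pt c : nat -> nat -> S := fun i j => phi (c i j).

Lemma bracket_morph c i j : phi (bracket c i j) = bracket (image_pt c) i j.
Proof.
have mX k l : phi (mulX c k l) = mulX (image_pt c) k l.
  by case: l => [|[|[|[|l]]]] //=; rewrite rmorph_nat.
have mY k l : phi (mulY c k l) = mulY (image_pt c) k l.
  by case: l => [|[|[|[|l]]]] //=; rewrite rmorph_nat.
rewrite /bracket rmorphB !rmorph_sum.
by congr (_ - _); apply: eq_bigr => k _; rewrite rmorphM mX mY.
Qed.

Let rm := (rmorphD, rmorphB, rmorphN, rmorphM, rmorphXn, rmorph1).

Lemma F1_morph c : phi (F1 c) = F1 (image_pt c).
Proof. by rewrite /F1 /prod3141 !rm. Qed.

Lemma F2_morph c : phi (F2 c) = F2 (image_pt c).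
Proof. by rewrite /F2 /P24 /Q24 /tail25 /tail34 !rm. Qed.

Lemma solved_morph c : solved c -> solved (image_pt c).
Proof.
move=> sol i j; rewrite /image_pt sol; move: i j.
by move=> [|[|[|[|[|[|i]]]]]] [|[|[|[|[|[|j]]]]]];
  rewrite /= /prod3141 /P24 /Q24 /tail25 /tail34 ?rm.
Qed.
End Naturality.

(** * Ideals, quotients and polynomial substitutions *)

Section Ideals.
Variables (R : comNzRingType) (I : idealr R).
Local Open Scope quotient_scope.

Definition pi_mod : {rmorphism R -> {ideal_quot I}} := \pi_({ideal_quot I}).

Lemma pi_mod_eq0 p : (pi_mod p == 0) = (p \in I).
Proof. by rewrite -(rmorph0 \pi_({ideal_quot I})) -Quotient.idealrBE subr0. Qed.

Lemma pi_mod_eq p q : (pi_mod p == pi_mod q) = (p - q \in I).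
Proof. by rewrite -subr_eq0 -rmorphB pi_mod_eq0. Qed.

Lemma pi_mod_repr (x : {ideal_quot I}) : pi_mod (repr x) = x.
Proof. exact: reprK. Qed.
End Ideals.

Section IdealSpanTheory.
Variables (R : comNzRingType) (J : finType) (g : J -> R).

Lemma ideal_span_gen j : g j \in ideal_span g.
Proof.
apply/asboolP; exists (fun k => (k == j)%:R).
rewrite (bigD1 j) //= eqxx mul1r big1 ?addr0 // => k kj.
by rewrite (negPf kj) mul0r.
Qed.

Lemma ideal_span_kernel (S : comNzRingType) (phi : {rmorphism R -> S}) p :
  (forall j, phi (g j) = 0) -> p \in ideal_span g -> phi p = 0.
Proof.
move=> g0 /asboolP[a ->]; rewrite rmorph_sum big1 // => j _.
by rewrite rmorphM g0 mulr0.
Qed.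
End IdealSpanTheory.

Lemma mpoly_hom_eq n (K R : comNzRingType) (f g : {rmorphism {mpoly K[n]} -> R}) :
  (forall a, f a%:MP = g a%:MP) -> (forall k, f 'X_k = g 'X_k) -> f =1 g.
Proof.
move=> eqC eqX p; rewrite (mpolyE p) !rmorph_sum; apply: eq_bigr => m _.
rewrite -mul_mpolyC !rmorphM /= eqC; congr (_ * _).
by rewrite mpolyXE_id !rmorph_prod; apply: eq_bigr => k _; rewrite !rmorphXn eqX.
Qed.

(** * The border ideal in terms of commuting tables *)

Section BorderIdeal.
Variable K : fieldType.

Definition exponents (m : 'X_{1..2}) : nat * nat := (m ord0, m ord_max).

Lemma exponents_inj : injective exponents.
Proof.
move=> m m' [e0 e1]; apply/mnmP => -[[|[|//]] i2].
  by rewrite (_ : Ordinal i2 = ord0) //; apply: val_inj.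
by rewrite (_ : Ordinal i2 = ord_max) //; apply: val_inj.
Qed.

Lemma exponents_L_ideal :
  map exponents L_ideal = [:: (0, 0); (0, 1); (1, 0); (0, 2); (2, 0)]%N.
Proof. by rewrite /= /exponents !(mnm0E, mulmnE, mnm1E). Qed.

Lemma exponents_L_border :
  map exponents L_border = [:: (1, 1); (0, 3); (1, 2); (2, 1); (3, 0)]%N.
Proof. by rewrite /= /exponents !(mnmDE, mulmnE, mnm1E). Qed.

(** Equality of multinomials does not compute, equality of pairs of exponents
does; the tests of the definition are transported to the latter. *)
Lemma gen_mult_mxE (r : 'I_2) (i j : 'I_5) :
  let e := nth (0, 0)%N [:: (0, 0); (0, 1); (1, 0); (0, 2); (2, 0)]%N in
  let u := ((r == ord0) + (e j).1, (r == ord_max) + (e j).2)%N in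
  gen_mult_mx K r i j =
    if u \in [:: (0, 0); (0, 1); (1, 0); (0, 2); (2, 0)]%N then (u == e i)%:R
    else cvar K i.+1
           (index u [:: (1, 1); (0, 3); (1, 2); (2, 1); (3, 0)]%N).+1.
Proof.
move=> e u; rewrite mxE; cbv zeta; set v := (U_(r) + _)%MM.
have eE (k : 'I_5) : e k = exponents (tnth L_ideal k).
  rewrite /e -exponents_L_ideal (nth_map 0%MM) ?size_tuple //.
  by rewrite (tnth_nth 0%MM).
have uE : u = exponents v.
  by rewrite /u eE /exponents /= !mnmDE !mnm1E.
rewrite uE eE -exponents_L_ideal -exponents_L_border.
by rewrite !(inj_eq exponents_inj, mem_map exponents_inj, index_map exponents_inj).
Qed.

Lemma gen_mult_mxX : gen_mult_mx K ord0 = mxX (cvar K).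
Proof.
apply/matrixP => i j; rewrite gen_mult_mxE mxE.
by case: i j => [[|[|[|[|[|//]]]]] ?] [[|[|[|[|[|//]]]]] ?].
Qed.

Lemma gen_mult_mxY : gen_mult_mx K ord_max = mxY (cvar K).
Proof.
apply/matrixP => i j; rewrite gen_mult_mxE mxE.
by case: i j => [[|[|[|[|[|//]]]]] ?] [[|[|[|[|[|//]]]]] ?].
Qed.

Lemma border_commutatorE i j : border_commutator K i j = bracket (cvar K) i j.
Proof. by rewrite /border_commutator gen_mult_mxX gen_mult_mxY mxbracketE. Qed.

Lemma border_ideal_kernel (S : comNzRingType)
    (phi : {rmorphism {mpoly K[25]} -> S}) p :
  commuting (image_pt phi (cvar K)) -> p \in border_ideal K -> phi p = 0.
Proof.
move=> com; apply: ideal_span_kernel => -[i j] /=.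
by rewrite border_commutatorE bracket_morph com.
Qed.

Lemma commuting_mod_border :
  commuting (image_pt (pi_mod (border_ideal K)) (cvar K)).
Proof.
move=> i j i5 j5; rewrite -bracket_morph; apply/eqP; rewrite pi_mod_eq0.
rewrite -[i]/(val (Ordinal i5)) -[j]/(val (Ordinal j5)) -border_commutatorE.
exact: (ideal_span_gen (fun ij => border_commutator K ij.1 ij.2)
                       (Ordinal i5, Ordinal j5)).
Qed.

Lemma F1_cvar x : solved x ->
  (forall i j, depth i j = 0%N -> x i j = cvar K i j) -> F1 x = Lf1 K.
Proof.
move=> sol free.
rewrite /F1 (sol 3 1)%N /= /prod3141 (sol 4 4)%N /= !free //.
by rewrite /Lf1; ring.
Qed.

Lemma F2_cvar x : solved x ->
  (forall i j, depth i j = 0%N -> x i j = cvar K i j) -> F2 x = Lf2 K.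
Proof.
move=> sol free; rewrite /F2 /P24 /Q24 /tail25 /tail34.
rewrite (sol 3 2)%N (sol 2 3)%N /= (sol 5 3)%N /= (sol 3 1)%N /= /prod3141.
rewrite (sol 4 4)%N /= !free //.
by rewrite /Lf2; ring.
Qed.
End BorderIdeal.

(** * The indeterminates as a table *)

Definition crow (k : 'I_25) : nat := (k %/ 5).+1.
Definition ccol (k : 'I_25) : nat := (k %% 5).+1.

Lemma cidxK k : cidx (crow k) (ccol k) = k.
Proof. by rewrite /cidx /= mulnC -divn_eq inord_val. Qed.

Lemma depth_le7 k : (depth (crow k) (ccol k) <= 7)%N.
Proof. by case: k; do 25![case=> [|] //]. Qed.

Lemma crowK i j : (depth i j <= 7)%N -> crow (cidx i j) = i.
Proof.
by move: i j => [|[|[|[|[|[|i]]]]]] [|[|[|[|[|[|j]]]]]] //= _;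
  rewrite /crow /cidx inordK.
Qed.

Lemma ccolK i j : (depth i j <= 7)%N -> ccol (cidx i j) = j.
Proof.
by move: i j => [|[|[|[|[|[|i]]]]]] [|[|[|[|[|[|j]]]]]] //= _;
  rewrite /ccol /cidx inordK.
Qed.

Lemma LZE k : (k \in LZ) = (0 < depth (crow k) (ccol k))%N.
Proof.
rewrite /LZ !inE -!val_eqE /= !inordK //.
by case: k; do 25![case=> [|] //].
Qed.

Definition point_of (R : Type) (c : nat -> nat -> R) : 'I_25 -> R :=
  fun k => c (crow k) (ccol k).

(** * The re-embedding *)

Section Reembedding.
Variable K : fieldType.
Local Notation P := {mpoly K[25]}.
Local Notation S := (subpoly K LZ).
Local Notation I := (border_ideal K).
Local Notation J := (Lf_ideal K).

Definition sub_val : {rmorphism S -> P} := val.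

Lemma sub_val_alg a : sub_val (in_alg S a) = a%:MP.
Proof. by rewrite -[LHS]/(a *: (1 : P)) alg_mpolyC. Qed.

Definition free_var (i j : nat) : S := insubd 0 (cvar K i j).

Lemma val_free_var i j : depth i j = 0%N -> sub_val (free_var i j) = cvar K i j.
Proof.
move=> d0; rewrite [LHS]insubdK //; apply: mfreeX.
by rewrite LZE crowK ?ccolK ?d0.
Qed.

(** The tautological point of the chart: its entries in Z are the h_z. *)
Definition chart_pt : nat -> nat -> S := s2val (solved_extension free_var).

Lemma chart_pt_solved : solved chart_pt.
Proof. exact: s2valP (solved_extension free_var). Qed.

Lemma val_chart_pt i j : depth i j = 0%N -> sub_val (chart_pt i j) = cvar K i j.
Proof.
move=> d0; rewrite /chart_pt (s2valP' (solved_extension free_var)) //.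
exact: val_free_var.
Qed.

Lemma val_chart_pt_solved : solved (image_pt sub_val chart_pt).
Proof. exact: solved_morph chart_pt_solved. Qed.

(** The substitution of h_z for each z in Z. *)
Definition elim_vars : {rmorphism P -> S} := mmap (in_alg S) (point_of chart_pt).

Lemma elim_varsX k : elim_vars 'X_k = chart_pt (crow k) (ccol k).
Proof. by rewrite /elim_vars /= mmapX mmap1U. Qed.

Lemma elim_vars_cvar i j :
  (depth i j <= 7)%N -> elim_vars (cvar K i j) = chart_pt i j.
Proof. by move=> d; rewrite elim_varsX crowK ?ccolK. Qed.

Lemma elim_varsZ a p : elim_vars (a *: p) = a *: elim_vars p.
Proof. by rewrite /elim_vars /= mmapZ /= mulr_algl. Qed.

Lemma chart_pt_free k :
  k \notin LZ -> sub_val (chart_pt (crow k) (ccol k)) = 'X_k.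
Proof.
by rewrite LZE -eqn0Ngt => /eqP d0; rewrite val_chart_pt // /cvar cidxK.
Qed.

Lemma elim_vars_val (q : S) : elim_vars (val q) = q.
Proof.
apply: val_inj; have /mfreeP free := subpolyP q.
rewrite [elim_vars _]/(mmap _ _ _) /mmap -[LHS]/(sub_val _) rmorph_sum.
rewrite [RHS]mpolyE !big_seq; apply: eq_bigr => m /free m0.
rewrite rmorphM rmorph_prod sub_val_alg mul_mpolyC; congr (_ *: _).
rewrite [RHS]mpolyXE_id; apply: eq_bigr => k _; rewrite rmorphXn.
have [kZ|kZ] := boolP (k \in LZ); first by rewrite m0 // !expr0.
by rewrite -(chart_pt_free kZ).
Qed.

Lemma F1_chart_pt : F1 chart_pt = Subpoly (Lf1_free K).
Proof.
apply: val_inj; rewrite -[LHS]/(sub_val _) F1_morph F1_cvar //.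
  exact: val_chart_pt_solved.
exact: val_chart_pt.
Qed.

Lemma F2_chart_pt : F2 chart_pt = Subpoly (Lf2_free K).
Proof.
apply: val_inj; rewrite -[LHS]/(sub_val _) F2_morph F2_cvar //.
  exact: val_chart_pt_solved.
exact: val_chart_pt.
Qed.

Lemma commuting_mod_Lf : commuting (image_pt (pi_mod J) chart_pt).
Proof.
pose f (b : bool) := if b then Subpoly (Lf1_free K) else Subpoly (Lf2_free K).
apply: commuting_of_solved; first exact: solved_morph chart_pt_solved.
  rewrite -F1_morph F1_chart_pt; apply/eqP; rewrite pi_mod_eq0.
  exact: (ideal_span_gen f true).
rewrite -F2_morph F2_chart_pt; apply/eqP; rewrite pi_mod_eq0.
exact: (ideal_span_gen f false).
Qed.

Lemma elim_vars_border p : p \in I -> elim_vars p \in J.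
Proof.
move=> pI; rewrite -pi_mod_eq0; apply/eqP.
rewrite -[LHS]/((pi_mod J \o elim_vars) p).
apply: border_ideal_kernel pI; apply: commuting_eq commuting_mod_Lf.
by move=> i j d; rewrite /image_pt /= elim_vars_cvar.
Qed.

Lemma cvar_mod_border i j : (depth i j <= 7)%N ->
  image_pt (pi_mod I) (cvar K) i j = image_pt (pi_mod I \o sub_val) chart_pt i j.
Proof.
have [sol _ _] := solved_of_commuting (commuting_mod_border K).
apply: solved_eq => //; first exact: solved_morph chart_pt_solved.
by move=> k l d0; rewrite /image_pt -(val_chart_pt d0).
Qed.

Lemma elim_vars_mod p : p - sub_val (elim_vars p) \in I.
Proof.
rewrite -pi_mod_eq0 rmorphB subr_eq0; apply/eqP.
apply: (mpoly_hom_eq (g := pi_mod I \o sub_val \o elim_vars)) => [a|k].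
  rewrite -[RHS]/(pi_mod I (sub_val (elim_vars _))) [elim_vars _]mmapC.
  by rewrite sub_val_alg.
rewrite -[RHS]/((pi_mod I \o sub_val) (elim_vars 'X_k)) elim_varsX.
rewrite -[in LHS](cidxK k); exact: cvar_mod_border (depth_le7 k).
Qed.

Lemma Lf_sub_border (q : S) : q \in J -> sub_val q \in I.
Proof.
move=> qJ; rewrite -pi_mod_eq0; apply/eqP.
rewrite -[LHS]/((pi_mod I \o sub_val) q).
have [_ f1 f2] := solved_of_commuting
  (commuting_eq cvar_mod_border (commuting_mod_border K)).
apply: ideal_span_kernel qJ; case.
  by rewrite -F1_chart_pt F1_morph.
by rewrite -F2_chart_pt F2_morph.
Qed.

Lemma Lf_eq_border (q : S) : (q \in J) = (val q \in I).
Proof.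
apply/idP/idP; first exact: Lf_sub_border.
by move/elim_vars_border; rewrite elim_vars_val.
Qed.

Local Open Scope quotient_scope.

Definition reembed (x : border_ring K) : {ideal_quot J} :=
  pi_mod J (elim_vars (repr x)).

Lemma reembed_pi p : reembed (pi_mod I p) = pi_mod J (elim_vars p).
Proof.
apply/eqP; rewrite pi_mod_eq -rmorphB; apply: elim_vars_border.
by rewrite -pi_mod_eq pi_mod_repr.
Qed.

Lemma reembed_zmod_morphism : zmod_morphism reembed.
Proof.
move=> x y; rewrite -[x]pi_mod_repr -[y]pi_mod_repr -rmorphB !reembed_pi.
by rewrite !rmorphB.
Qed.

Lemma reembed_monoid_morphism : monoid_morphism reembed.
Proof.
split; first by rewrite -(rmorph1 (pi_mod I)) reembed_pi !rmorph1.
move=> x y; rewrite -[x]pi_mod_repr -[y]pi_mod_repr -rmorphM !reembed_pi.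
by rewrite !rmorphM.
Qed.

Lemma reembed_scalable : scalable reembed.
Proof.
move=> a x; rewrite -[x]pi_mod_repr -[a *: _](pi_quotZ (border_ideal K) a).
rewrite [LHS]reembed_pi elim_varsZ reembed_pi.
exact: pi_quotZ.
Qed.

HB.instance Definition _ :=
  GRing.isZmodMorphism.Build _ _ reembed reembed_zmod_morphism.
HB.instance Definition _ :=
  GRing.isMonoidMorphism.Build _ _ reembed reembed_monoid_morphism.
HB.instance Definition _ :=
  GRing.isScalable.Build K _ _ _ reembed reembed_scalable.

Definition reembed_inv (y : {ideal_quot J}) : border_ring K :=
  pi_mod I (sub_val (repr y)).

Lemma reembed_inv_pi q : reembed_inv (pi_mod J q) = pi_mod I (sub_val q).
Proof.
apply/eqP; rewrite pi_mod_eq -rmorphB.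
by apply: Lf_sub_border; rewrite -pi_mod_eq pi_mod_repr.
Qed.

Lemma reembed_bij : bijective reembed.
Proof.
exists reembed_inv => [x|y].
  rewrite -[x]pi_mod_repr reembed_pi reembed_inv_pi; apply/eqP.
  by rewrite pi_mod_eq -opprB rpredN elim_vars_mod.
by rewrite -[y]pi_mod_repr reembed_inv_pi reembed_pi elim_vars_val.
Qed.

Lemma LZ_reembedding :
  exists Phi : {lrmorphism border_ring K -> {ideal_quot (Lf_ideal K)}},
    separating_reembedding Phi.
Proof.
exists reembed; split.
- exact: Lf_eq_border.
- exists (fun k => elim_vars 'X_k) => z _; split; first exact: elim_vars_mod.
  exact: reembed_pi.
- move=> q; rewrite -[LHS]/(reembed (pi_mod I (sub_val q))).
  by rewrite reembed_pi elim_vars_val.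
- exact: reembed_bij.
Qed.
End Reembedding.

(** * Elimination orderings *)

Section Elimination.
Variables (n : nat) (K : fieldType) (Z : seq 'I_n).

Definition degree_in (m : 'X_{1..n}) : nat := \sum_(z <- Z) m z.

Definition elim_le : rel 'X_{1..n} := fun m m' =>
  (degree_in m < degree_in m')%N
  || (degree_in m == degree_in m') && (m <= m')%O.

Lemma degree_inD m m' :
  degree_in (m + m')%MM = (degree_in m + degree_in m')%N.
Proof.
by rewrite /degree_in -big_split; apply: eq_bigr => z _; rewrite mnmDE.
Qed.

Lemma elim_le_term_ordering : term_ordering elim_le.
Proof.
split.
- move=> m m'; rewrite /elim_le; case: ltngtP => //= _.
  exact: Order.TotalTheory.le_total.
- move=> m m'; rewrite /elim_le; case: ltngtP => //= _.
  exact: Order.POrderTheory.le_anti.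
- move=> m2 m1 m3; rewrite /elim_le.
  case: (ltngtP (degree_in m1) (degree_in m2)) => //= [lt12 _|->].
    case: (ltngtP (degree_in m2) (degree_in m3)) => //= [lt23|<- _].
      by rewrite (ltn_trans lt12 lt23).
    by rewrite lt12.
  move=> le12; case: ltngtP => //= _; exact: Order.POrderTheory.le_trans.
- move=> m; rewrite /elim_le; have -> : degree_in 0%MM = 0%N.
    by rewrite /degree_in big1 // => z _; rewrite mnm0E.
  by case: (degree_in m) => //=; rewrite le0m.
- move=> m m1 m2.
  by rewrite /elim_le !degree_inD ltn_add2r eqn_add2r lemc_add2l.
Qed.

Lemma separating_of_solved (I : {pred {mpoly K[n]}})
    (h : 'I_n -> {mpoly K[n]}) :
  uniq Z -> {in Z, forall z, h z \in mfree Z /\ 'X_z - h z \in I} ->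
  separating I Z.
Proof.
move=> uZ hI; split=> //; exists elim_le; first exact: elim_le_term_ordering.
move=> z zZ; have [/mfreeP hf pI] := hI z zZ; exists ('X_z - h z) => //.
have hz : U_(z)%MM \notin msupp (h z).
  by apply/negP => /hf/(_ z zZ); rewrite mnm1E eqxx.
split.
  rewrite mcoeff_msupp mcoeffB mcoeffX eqxx (memN_msupp_eq0 hz) subr0.
  exact: oner_neq0.
move=> m /msuppB_le; rewrite mem_cat msuppX inE => /orP[/eqP->|/hf m0].
  by rewrite /elim_le eqxx Order.POrderTheory.lexx orbT.
rewrite /elim_le; have -> : degree_in m = 0%N by rewrite /degree_in big_seq big1.
by rewrite /degree_in (big_rem z) //= mnm1E eqxx.
Qed.
End Elimination.

Lemma LZ_separating (K : fieldType) : separating (border_ideal K) LZ.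
Proof.
apply: (@separating_of_solved _ _ _ _ (fun k => val (elim_vars K 'X_k))).
  by rewrite /LZ -(map_inj_uniq val_inj) /= !inordK.
by move=> z _; split; [exact: subpolyP | exact: elim_vars_mod].
Qed.

(** * Separated coordinates are determined by the others *)

Lemma seq_minimum (T : eqType) (le : rel T) (s : seq T) :
  total le -> transitive le -> s != [::] ->
  exists2 x, x \in s & {in s, forall y, le x y}.
Proof.
move=> tot tr; elim: s => // x [|y s] IHs _.
  exists x; rewrite ?mem_head // => y; rewrite inE => /eqP->.
  by case/orP: (tot x x).
have [z zs zmin] := IHs isT.
case/orP: (tot x z) => xz.
  exists x; first exact: mem_head.
  move=> t; rewrite inE => /predU1P[->|/zmin]; first by case/orP: (tot x x).
  exact: tr.
exists z; first by rewrite inE zs orbT.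
by move=> t; rewrite inE => /predU1P[->|/zmin].
Qed.

(** If two points agree outside Z, let z be the smallest indeterminate at which
they differ. All other terms of the polynomial of I with leading term z are
products of indeterminates smaller than z, hence take the same value at both
points; so does z. *)
Lemma separating_determines n (K : fieldType) (I : {pred {mpoly K[n]}})
    (Z : seq 'I_n) (S : comNzRingType) (iota : {rmorphism K -> S})
    (v v' : 'I_n -> S) :
  separating I Z ->
  {in I, forall p, mmap iota v p = 0} -> {in I, forall p, mmap iota v' p = 0} ->
  (forall k, k \notin Z -> v k = v' k) -> v =1 v'.
Proof.
move=> [_ [le [tot anti tr le0 leD] ltZ]] I0 I0' eqZ.
pose bad := [seq z <- Z | v z != v' z]; pose leU := relpre (fun k => U_(k)%MM) le.
have [bad0|/(seq_minimum (le := leU))] := eqVneq bad [::].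
  move=> k; have [kZ|/eqZ//] := boolP (k \in Z).
  apply/eqP/negPn/negP => vk; suff : k \in bad by rewrite bad0.
  by rewrite mem_filter vk.
case=> [k l|k l m|z]; [exact: tot | exact: tr |].
rewrite mem_filter => /andP[vz zZ] zmin.
have [p pI [zp ltz]] := ltZ z zZ.
have same m : m \in msupp p -> m != U_(z)%MM -> mmap1 v m = mmap1 v' m.
  move=> mp mz; apply: eq_bigr => k _; have [-> //|mk] := eqVneq (m k) 0%N.
  congr (_ ^+ _); apply: contraTeq mz => vk; rewrite negbK; apply/eqP.
  have kZ : k \in Z by apply: contraNT vk => /eqZ->.
  have lekm : le U_(k)%MM m.
    have := leD U_(k)%MM _ _ (le0 (m - U_(k))%MM).
    by rewrite add0m submK // lep1mP.
  have lezk : le U_(z)%MM U_(k)%MM by apply: zmin; rewrite mem_filter vk.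
  by apply: anti; rewrite ltz //= (tr _ _ _ lezk lekm).
have rest : \sum_(m <- msupp p | m != U_(z)%MM) iota p@_m * mmap1 v m =
            \sum_(m <- msupp p | m != U_(z)%MM) iota p@_m * mmap1 v' m.
  rewrite big_seq_cond [RHS]big_seq_cond; apply: eq_bigr => m /andP[mp mz].
  by rewrite same.
have := I0' p pI; rewrite -(I0 p pI) /mmap.
rewrite !(bigD1_seq _ zp (msupp_uniq p)) /= rest !mmap1U => /addIr eqz.
case/eqP: vz; rewrite -[v z]mul1r -[v' z]mul1r -(rmorph1 iota).
rewrite -(mulVf (x := p@_U_(z))) -?mcoeff_msupp //.
by rewrite rmorphM -!mulrA eqz.
Qed.

Section TwoPoints.
Variables (K : fieldType) (S : comNzRingType) (iota : {rmorphism K -> S}).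

Lemma border_ideal_point (c : nat -> nat -> S) p :
  commuting c -> p \in border_ideal K -> mmap iota (point_of c) p = 0.
Proof.
move=> com pI.
apply: (border_ideal_kernel (phi := mmap iota (point_of c))) pI.
apply: commuting_eq com => i j dij.
by rewrite /image_pt /= mmapX mmap1U /point_of crowK ?ccolK.
Qed.

Lemma separating_misses (Z : seq 'I_25) (c c' : nat -> nat -> S)
    (D : seq (nat * nat)) :
  separating (border_ideal K) Z -> commuting c -> commuting c' ->
  (forall i j, (depth i j <= 7)%N -> (i, j) \notin D -> c i j = c' i j) ->
  (exists i j, (depth i j <= 7)%N /\ c i j <> c' i j) ->
  has (fun ij => cidx ij.1 ij.2 \notin Z) D.
Proof.
move=> sepZ com com' eqD [i [j [dij neq]]]; apply/negPn/negP => /hasPn DZ.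
apply: neq; suff: point_of c =1 point_of c'.
  by move=> /(_ (cidx i j)); rewrite /point_of crowK ?ccolK.
apply: (separating_determines (iota := iota) sepZ).
- by move=> p; apply: border_ideal_point.
- by move=> p; apply: border_ideal_point.
move=> k kZ; apply: eqD; first exact: depth_le7.
by apply/negP => /DZ /=; rewrite cidxK kZ.
Qed.
End TwoPoints.

(** * Curves on the scheme *)

Definition entry (S : Type) (i j : nat) (x : S) : nat * nat * S := (i, j, x).

Fixpoint sparse (S : comNzRingType) (s : seq (nat * nat * S)) (i j : nat) : S :=
  if s is (k, l, x) :: s' then
    if (k == i) && (l == j) then x else sparse s' i j
  else 0.

(** Each table below is a point of the chart whose free entries are chosen so that
few entries change when t changes sign. *)
Section Curves.
Variable S : comNzRingType.
Implicit Types t w : S.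

Ltac commute :=
  apply: commuting_row0 => -[|[|[|[|[|?]]]]] [|[|[|[|[|?]]]]] // _ _;
  rewrite bracketE /=.

Lemma axis_commuting (i j : nat) t :
  (i, j) \in [:: (2, 2); (3, 5); (4, 1); (4, 2);
                 (4, 5); (5, 1); (5, 2); (5, 5)]%N ->
  commuting (sparse [:: entry i j t]).
Proof.
rewrite !inE !xpair_eqE.
by do ?[case/orP] => /andP[/eqP-> /eqP->]; commute; ring.
Qed.

Definition curve2143 t : nat -> nat -> S := sparse
  [:: entry 2 1 t; entry 4 3 t; entry 2 4 (t ^+ 2); entry 3 5 (t ^+ 2)].

Lemma curve2143_commuting t : commuting (curve2143 t).
Proof. by rewrite /curve2143; commute; ring. Qed.

Definition curve3154 t : nat -> nat -> S := sparse
  [:: entry 3 1 t; entry 5 4 t; entry 3 3 (t ^+ 2); entry 2 2 (t ^+ 2)].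

Lemma curve3154_commuting t : commuting (curve3154 t).
Proof. by rewrite /curve3154; commute; ring. Qed.

Definition curve4344 t : nat -> nat -> S := sparse
  [:: entry 4 1 1; entry 5 1 1; entry 4 3 t; entry 4 4 t;
      entry 1 1 (- t ^+ 2); entry 2 4 (t ^+ 2); entry 2 5 (t ^+ 2);
      entry 3 5 (t ^+ 2)].

Lemma curve4344_commuting t : commuting (curve4344 t).
Proof. by rewrite /curve4344; commute; ring. Qed.

Definition curve5354 t : nat -> nat -> S := sparse
  [:: entry 4 1 1; entry 5 1 1; entry 5 3 t; entry 5 4 t;
      entry 1 1 (- t ^+ 2); entry 3 3 (t ^+ 2); entry 3 2 (t ^+ 2);
      entry 2 2 (t ^+ 2)].

Lemma curve5354_commuting t : commuting (curve5354 t).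
Proof. by rewrite /curve5354; commute; ring. Qed.

Definition line33 w t : nat -> nat -> S := sparse
  [:: entry 4 1 1; entry 5 1 w; entry 3 3 t; entry 2 3 (- t);
      entry 2 4 (- 2%:R * t); entry 2 5 (- 2%:R * t); entry 3 2 (w * t);
      entry 3 4 t].

Lemma line33_commuting w t : 2%:R * w = 1 -> commuting (line33 w t).
Proof.
move=> w2; have z k : (2%:R * w - 1) * k = 0 by rewrite w2 subrr mul0r.
by rewrite /line33; commute; first [ring
  | transitivity ((2%:R * w - 1) * t); [ring | exact: z]
  | transitivity ((2%:R * w - 1) * - t); [ring | exact: z]].
Qed.

Definition curve2131 w t : nat -> nat -> S := sparse
  [:: entry 4 1 w; entry 5 1 1; entry 2 1 t; entry 3 1 (w * t);
      entry 4 4 (w * t); entry 5 3 (w * t); entry 1 2 (- t ^+ 3);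
      entry 1 5 (- t ^+ 3); entry 1 1 (t ^+ 2); entry 2 3 ((1 + w) * t ^+ 2);
      entry 3 4 ((1 + w) * t ^+ 2)].

Lemma curve2131_commuting w t : w ^+ 2 = - 1 - w -> commuting (curve2131 w t).
Proof. by move=> w2; rewrite /curve2131; commute; ring: w2. Qed.
End Curves.

(** * What a separating tuple must miss *)

Section Misses.
Variables (K : fieldType) (Z : seq 'I_25).
Hypothesis sepZ : separating (border_ideal K) Z.
Let idK : {rmorphism K -> K} := idfun.
Let missed (ij : nat * nat) := cidx ij.1 ij.2 \notin Z.

Ltac even_off_D :=
  move=> [|[|[|[|[|[|i]]]]]] [|[|[|[|[|[|j]]]]]] //= _ _; ring.

Lemma missed_axis i j :
  (i, j) \in [:: (2, 2); (3, 5); (4, 1); (4, 2);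
                 (4, 5); (5, 1); (5, 2); (5, 5)]%N ->
  cidx i j \notin Z.
Proof.
move=> ij; have : has missed [:: (i, j)]; last by rewrite /= orbF.
apply: (separating_misses idK sepZ (axis_commuting 0 ij) (axis_commuting 1 ij)).
  move=> k l _; rewrite inE xpair_eqE [k == i]eq_sym [l == j]eq_sym.
  by move=> /negPf kl; rewrite /sparse /= kl.
exists i, j; split; last first.
  by rewrite /sparse /= !eqxx => /eqP; rewrite eq_sym oner_eq0.
by move: ij; rewrite !inE !xpair_eqE; do ?[case/orP] => /andP[/eqP-> /eqP->].
Qed.

Hypothesis two_neq0 : 2%:R != 0 :> K.

Lemma one_neq_opp1 (S : comNzRingType) (iota : {rmorphism K -> S}) :
  1 <> - 1 :> S.
Proof.
move=> e; have two0 : 2%:R = 0 :> S.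
  by apply/eqP; rewrite mulr2n addr_eq0; apply/eqP.
case/eqP: (oner_neq0 S); rewrite -(rmorph1 iota) -(mulVf two_neq0) rmorphM.
by rewrite rmorph_nat two0 mulr0.
Qed.

Let one_neq_opp1K : 1 <> - 1 :> K := one_neq_opp1 idK.

Lemma missed_2143 : has missed [:: (2, 1); (4, 3)]%N.
Proof.
apply: (separating_misses idK sepZ (curve2143_commuting 1)
                          (curve2143_commuting (- 1))).
  by rewrite /curve2143; even_off_D.
by exists 2%N, 1%N.
Qed.

Lemma missed_3154 : has missed [:: (3, 1); (5, 4)]%N.
Proof.
apply: (separating_misses idK sepZ (curve3154_commuting 1)
                          (curve3154_commuting (- 1))).
  by rewrite /curve3154; even_off_D.
by exists 3%N, 1%N.
Qed.

Lemma missed_4344 : has missed [:: (4, 3); (4, 4)]%N.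
Proof.
apply: (separating_misses idK sepZ (curve4344_commuting 1)
                          (curve4344_commuting (- 1))).
  by rewrite /curve4344; even_off_D.
by exists 4%N, 3%N.
Qed.

Lemma missed_5354 : has missed [:: (5, 3); (5, 4)]%N.
Proof.
apply: (separating_misses idK sepZ (curve5354_commuting 1)
                          (curve5354_commuting (- 1))).
  by rewrite /curve5354; even_off_D.
by exists 5%N, 3%N.
Qed.

Lemma missed_33 :
  has missed [:: (2, 3); (2, 4); (2, 5); (3, 2); (3, 3); (3, 4)]%N.
Proof.
have half := mulfV two_neq0.
apply: (separating_misses idK sepZ (line33_commuting 1 half)
                          (line33_commuting (- 1) half)).
  by rewrite /line33; even_off_D.
by exists 3%N, 3%N.
Qed.

Lemma cube_root_of_unity : exists (L : fieldType) (iota : {rmorphism K -> L})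
  (w : L), w ^+ 2 = - 1 - w.
Proof.
pose p : {poly K} := 'X^2 + 'X + 1.
have p3 : size p = 3%N.
  rewrite /p -addrA size_polyDl size_polyXn //.
  by rewrite size_polyDl size_polyX ?size_poly1.
have [[w /rootP pw]|noroot] := pselect (exists w, root p w).
  exists K, idK, w; move: pw; rewrite /p !hornerE => pw.
  by rewrite -[RHS]addr0 -[X in _ + X]pw; ring.
have [|L _ [w /rootP pw _]] := irredp_FAdjoin (p := p).
  apply: cubic_irreducible; first by rewrite p3.
  by move=> w; apply/negP => rw; case: noroot; exists w.
exists L, (in_alg L), w; move: pw.
rewrite /p !rmorphD /= map_polyXn map_polyX rmorph1 !hornerE => pw.
by rewrite -[RHS]addr0 -[X in _ + X]pw; ring.
Qed.

Lemma missed_2131 :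
  has missed [:: (2, 1); (3, 1); (1, 2); (1, 5); (4, 4); (5, 3)]%N.
Proof.
have [L [iota [w w2]]] := cube_root_of_unity.
apply: (separating_misses iota sepZ (curve2131_commuting 1 w2)
                          (curve2131_commuting (- 1) w2)).
  by rewrite /curve2131; even_off_D.
exists 2%N, 1%N; split => //=; exact: one_neq_opp1 iota.
Qed.
End Misses.

Lemma separating_size_le13 (K : fieldType) (Z : seq 'I_25) :
  2%N \notin [pchar K] -> separating (border_ideal K) Z -> (size Z <= 13)%N.
Proof.
move=> char2 sepZ; have two : 2%:R != 0 :> K.
  by apply: contra char2 => /eqP two; rewrite inE /= two eqxx.
have sizeE : size Z = (\sum_(0 <= k < 25) (inord k \in Z))%N.
  have /card_uniqP <- : uniq Z by case: sepZ.
  rewrite -sum1_card big_mkcond /= big_mkord; apply: eq_bigr => k _.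
  by rewrite inord_val; case: (k \in Z).
(* From here on c_{ij} is denoted by its number 5 (i - 1) + (j - 1). *)
pose m k := inord k \in Z; pose x k : nat := m k.
have x_axis k : k \in [:: 6; 14; 15; 16; 19; 20; 21; 24]%N -> x k = 0%N.
  move=> kB; have := missed_axis sepZ (i := (k %/ 5).+1) (j := (k %% 5).+1).
  rewrite /x /m /cidx /= mulnC -divn_eq => /(_ _)/negPf-> //.
  by move: kB; rewrite !inE; do ?[case/orP] => /eqP->.
have m2143 : ~~ m 5 || ~~ m 17.
  by have := missed_2143 sepZ two; rewrite /= orbF.
have m3154 : ~~ m 10 || ~~ m 23.
  by have := missed_3154 sepZ two; rewrite /= orbF.
have m4344 : ~~ m 17 || ~~ m 18.
  by have := missed_4344 sepZ two; rewrite /= orbF.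
have m5354 : ~~ m 22 || ~~ m 23.
  by have := missed_5354 sepZ two; rewrite /= orbF.
have m33 : [|| ~~ m 7, ~~ m 8, ~~ m 9, ~~ m 11, ~~ m 12 | ~~ m 13].
  by have := missed_33 sepZ two; rewrite /= orbF.
have m2131 : [|| ~~ m 5, ~~ m 10, ~~ m 1, ~~ m 4, ~~ m 18 | ~~ m 22].
  by have := missed_2131 sepZ two; rewrite /= orbF.
(* If only two of these eight were missed, one of each of the first two pairs,
   then c44 and c53 would be in Z, so c43 and c54 would not, so c21 and c31
   would be in Z, against m2131. *)
have le5 : (x 1 + x 4 + x 5 + x 10 + x 17 + x 18 + x 22 + x 23 <= 5)%N.
  rewrite /x; move: m2143 m3154 m4344 m5354 m2131.
  case: (m 1); case: (m 4); case: (m 5); case: (m 10);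
  by case: (m 17); case: (m 18); case: (m 22); case: (m 23).
have le5' : (x 7 + x 8 + x 9 + x 11 + x 12 + x 13 <= 5)%N.
  rewrite /x; move: m33; case: (m 7); case: (m 8); case: (m 9);
  by case: (m 11); case: (m 12); case: (m 13).
have le3 : (x 0 + x 2 + x 3 <= 3)%N.
  by rewrite /x; case: (m 0); case: (m 2); case: (m 3).
have -> : size Z = (\sum_(0 <= k < 25) x k)%N := sizeE.
rewrite unlock /= (x_axis 6) ?(x_axis 14) ?(x_axis 15) ?(x_axis 16) ?(x_axis 19)
  ?(x_axis 20) ?(x_axis 21) ?(x_axis 24) //.
clearbody x; move: le5 le5' le3; clear; lia.
Qed.

Theorem proposition4p3 (K : fieldType) (hK : perfect_field K) :
  [/\ separating (border_ideal K) LZ,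
      2%N \notin [pchar K] -> best_separating (border_ideal K) LZ
    & exists Phi : {lrmorphism border_ring K -> {ideal_quot (Lf_ideal K)}},
        separating_reembedding Phi].
Proof.
split; first exact: LZ_separating.
  move=> char2; split; first exact: LZ_separating.
  by move=> Z' sepZ'; apply: separating_size_le13 sepZ'.
exact: LZ_reembedding.
Qed.
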